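(* Let $\Omega\subset\mathbb{R}^n$ be a nonempty closed set and let $g\colon\mathbb{R}^n\to\mathbb{R}\cup\{+\infty\}$ be a lower semicontinuous function such that $\Omega\cap\mathrm{dom}\, g$ is nonempty and unbounded. Let $S:=\{x\in\Omega : g(x)\le 0\}$. Assume that $$\partial^\infty g(\infty)\cap\big(-N(\infty;\Omega)\big)=\{0\}$$ and $$0\notin \partial g(\infty)+N(\infty;\Omega).$$ Then $S$ has an error bound at infinity, i.e., there exist $\alpha>0$ and $R>0$ such that $$d(x;S)\le\alpha\,[g(x)]_+\quad\text{for all } x\in\Omega \text{ with } \|x\|>R.$$
   Context: $\mathbb{R}^n$ carries the Euclidean norm; $d(x;S):=\inf\{\|y-x\| : y\in S\}$; $[t]_+:=\max\{t,0\}$; $\mathrm{dom}\,g:=\{x : g(x)<+\infty\}$; $\mathrm{epi}\,g:=\{(x,\alpha)\in\mathbb{R}^n\times\mathbb{R} : \alpha\ge g(x)\}$. Normal cones. For $C\subset\mathbb{R}^d$ and $\bar x\in C$, the Fréchet normal cone is $\widehat N(\bar x;C):=\{v\in\mathbb{R}^d : \limsup_{x\to\bar x,\,x\in C}\langle v,x-\bar x\rangle/\|x-\bar x\|\le 0\}$. The limiting normal cone $N(\bar x;C)$ is the set of all $v$ for which there exist $x_k\in C$, $x_k\to\bar x$, and $v_k\in\widehat N(x_k;C)$ with $v_k\to v$. Normal cone at infinity. For an unbounded closed $\Omega\subset\mathbb{R}^n$, $N(\infty;\Omega)$ is the set of all $v$ for which there exist $x_k\in\Omega$ with $\|x_k\|\to\infty$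 and $v_k\in\widehat N(x_k;\Omega)$ with $v_k\to v$. Subdifferentials at infinity. For a lower semicontinuous $g\colon\mathbb{R}^n\to\mathbb{R}\cup\{+\infty\}$ with unbounded domain, let $\mathcal{N}$ be the set of all $w\in\mathbb{R}^n\times\mathbb{R}$ for which there exist $x_k\in\mathrm{dom}\,g$ with $\|x_k\|\to\infty$ and $w_k\in N((x_k,g(x_k));\mathrm{epi}\,g)$ with $w_k\to w$. Then $\partial g(\infty):=\{u : (u,-1)\in\mathcal{N}\}$ and $\partial^\infty g(\infty):=\{u : (u,0)\in\mathcal{N}\}$.
   Formalization: The set S is additionally assumed nonempty; otherwise d(x;S) is the infimum of the empty set, +∞, and the claim fails, e.g. for Ω = ℝ and g(x) = |x| + 1, where both conditions at infinity hold but S is empty. *)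

(* Defs.v *)
From HB Require Import structures.
From mathcomp Require Import all_boot all_order all_algebra.
From mathcomp Require Import all_classical all_reals all_analysis.
Set Implicit Arguments.
Unset Strict Implicit.
Unset Printing Implicit Defensive.
Import Order.TTheory GRing.Theory Num.Theory.
Import numFieldNormedType.Exports.
Local Open Scope classical_set_scope.
Local Open Scope ring_scope.

(* R^n is 'rV[R]_n. The library norm on 'rV[R]_n is the sup norm, so the
   Euclidean structure is introduced here; the library topology, used for
   limits, closedness and semicontinuity, is the Euclidean one. *)
Definition dot (R : realType) (n : nat) (u v : 'rV[R]_n) : R :=
  \sum_(i < n) u ord0 i * v ord0 i.

Definition enorm (R : realType) (n : nat) (u : 'rV[R]_n) : R :=
  Num.sqrt (dot u u).

Definition unbounded (R : realType) (n : nat) (A : set 'rV[R]_n) : Prop :=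
  forall M : R, exists2 x, A x & M < enorm x.

(* As usual, the infimum over the empty set is +oo. *)
Definition dist_set (R : realType) (n : nat) (x : 'rV[R]_n)
    (A : set 'rV[R]_n) : \bar R :=
  ereal_inf [set (enorm (y - x))%:E | y in A].

Definition edom (R : realType) (n : nat) (g : 'rV[R]_n -> \bar R) :
    set 'rV[R]_n :=
  [set x | (g x < +oo)%E].

(* R^n x R is identified with R^(n+1), the real component coming last. *)
Definition pair_mx (R : realType) (n : nat) (x : 'rV[R]_n) (a : R) :
    'rV[R]_(n + 1) :=
  row_mx x (const_mx a).

Definition epi (R : realType) (n : nat) (g : 'rV[R]_n -> \bar R) :
    set 'rV[R]_(n + 1) :=
  [set w | exists x a, w = pair_mx x a /\ (g x <= a%:E)%E].

(* The upper limit is taken over x in C, x != xbar; at an isolated point of C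
   it is -oo, so that every v is normal there. *)
Definition frechet_normal (R : realType) (d : nat) (xbar : 'rV[R]_d)
    (C : set 'rV[R]_d) : set 'rV[R]_d :=
  [set v | (limf_esup (fun x : 'rV[R]_d => (dot v (x - xbar) / enorm (x - xbar))%:E)
                      (within C xbar^') <= 0)%E].

Definition limiting_normal (R : realType) (d : nat) (xbar : 'rV[R]_d)
    (C : set 'rV[R]_d) : set 'rV[R]_d :=
  [set v : 'rV[R]_d | exists x_ v_ : nat -> 'rV[R]_d,
    [/\ forall k, C (x_ k),
        x_ @ \oo --> xbar,
        forall k, frechet_normal (x_ k) C (v_ k) &
        v_ @ \oo --> v]].

Definition normal_at_infty (R : realType) (n : nat) (Omega : set 'rV[R]_n) :
    set 'rV[R]_n :=
  [set v : 'rV[R]_n | exists x_ v_ : nat -> 'rV[R]_n,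
    [/\ forall k, Omega (x_ k),
        enorm (x_ k) @[k --> \oo] --> +oo,
        forall k, frechet_normal (x_ k) Omega (v_ k) &
        v_ @ \oo --> v]].

(* g is meant to be -oo-free, so that fine (g x) is g x on the domain of g. *)
Definition epi_normal_at_infty (R : realType) (n : nat)
    (g : 'rV[R]_n -> \bar R) : set 'rV[R]_(n + 1) :=
  [set w | exists (x_ : nat -> 'rV[R]_n) (w_ : nat -> 'rV[R]_(n + 1)),
    [/\ forall k, edom g (x_ k),
        enorm (x_ k) @[k --> \oo] --> +oo,
        forall k, limiting_normal (pair_mx (x_ k) (fine (g (x_ k))))
                                  (epi g) (w_ k) &
        w_ @ \oo --> w]].

Definition subdiff_at_infty (R : realType) (n : nat)
    (g : 'rV[R]_n -> \bar R) : set 'rV[R]_n :=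
  [set u | epi_normal_at_infty g (pair_mx u (- 1))].

Definition singular_subdiff_at_infty (R : realType) (n : nat)
    (g : 'rV[R]_n -> \bar R) : set 'rV[R]_n :=
  [set u | epi_normal_at_infty g (pair_mx u 0)].

(* Main.v *)
Require Import Defs.
From HB Require Import structures.
From mathcomp Require Import all_boot all_order all_algebra.
From mathcomp Require Import all_classical all_reals all_analysis.
From mathcomp Require Import ring lra.
Import Order.TTheory GRing.Theory Num.Theory.
Import numFieldNormedType.Exports.
Local Open Scope classical_set_scope.
Local Open Scope ring_scope.
Set Implicit Arguments.
Unset Strict Implicit.

(** If the error bound fails, some points [x0] of [Omega] of arbitrarily large
    norm have a finite value [r = g x0 > 0] that is negligible with respect to
    their distance to [S]. Choosing a radius [l] with [r / l] small and a ball
    of radius [l] around [x0] that avoids [S], one minimizes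
      [a + (r / l^2) |x - x0|^2 + j |x - z|^2]
    over [(x, a)] in the epigraph of [g] with [0 <= a] and over [z] in [Omega].
    In finite dimension a minimizer exists; the objective being smooth and the
    variables [(x, a)] and [z] independent, the optimality conditions separate
    into a normal [(u, -1)] to the epigraph at [(x, g x)] and a normal [v] to
    [Omega] at [z] ([penalized_minimizer], [penalized_normals]). Because [2 j (x - z)] enters
    [u] and [v] with opposite signs, [u + v] is at most [2 r / l]
    ([far_opposite_normals]). The points [x] and [z] go to infinity with [x0].

    The normals [v] need not be bounded, so the vectors [(v, 1)] are first
    normalized; a cluster point [(v, s)] with [|v| + s = 1] and [s >= 0] is such
    that [(- v, - s)] is a limit of normals to the epigraph at infinity and [v]
    is a normal to [Omega] at infinity ([normalized_opposite_normals]). If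
    [s = 0], then [- v] is a nonzero singular subgradient at infinity opposite
    to a normal at infinity, which the qualification condition forbids. If
    [0 < s], dividing by [s] writes zero as the sum of a subgradient at infinity
    and a normal at infinity, which the regularity condition forbids. *)

(** * The Euclidean inner product and norm *)

Lemma dotC (R : realType) n (u v : 'rV[R]_n) : dot u v = dot v u.
Proof. by apply: eq_bigr => i _; rewrite mulrC. Qed.

Lemma dotDl (R : realType) n (u v w : 'rV[R]_n) :
  dot (u + v) w = dot u w + dot v w.
Proof.
by rewrite /dot -big_split; apply: eq_bigr => i _; rewrite mxE mulrDl.
Qed.

Lemma dotZl (R : realType) n (a : R) (u v : 'rV[R]_n) :
  dot (a *: u) v = a * dot u v.
Proof. by rewrite /dot mulr_sumr; apply: eq_bigr => i _; rewrite mxE mulrA. Qed.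

Lemma dotNl (R : realType) n (u v : 'rV[R]_n) : dot (- u) v = - dot u v.
Proof. by rewrite -scaleN1r dotZl mulN1r. Qed.

Lemma dotDr (R : realType) n (u v w : 'rV[R]_n) :
  dot u (v + w) = dot u v + dot u w.
Proof. by rewrite ![dot u _]dotC dotDl. Qed.

Lemma dotZr (R : realType) n (a : R) (u v : 'rV[R]_n) :
  dot u (a *: v) = a * dot u v.
Proof. by rewrite ![dot u _]dotC dotZl. Qed.

Lemma dotNr (R : realType) n (u v : 'rV[R]_n) : dot u (- v) = - dot u v.
Proof. by rewrite ![dot u _]dotC dotNl. Qed.

Lemma dot_ge0 (R : realType) n (u : 'rV[R]_n) : 0 <= dot u u.
Proof. by apply: sumr_ge0 => i _; rewrite -expr2 sqr_ge0. Qed.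

Lemma sqdist_expand (R : realType) n (p q y : 'rV[R]_n) :
  dot (q - y) (q - y) =
  dot (p - y) (p - y) + 2 * dot (p - y) (q - p) + dot (q - p) (q - p).
Proof.
have -> : q - y = (p - y) + (q - p) by rewrite [RHS]addrC addrA subrK.
by rewrite (dotDl (p - y)) !(dotDr _ (p - y)) (dotC (q - p) (p - y)); ring.
Qed.

Lemma enorm_ge0 (R : realType) n (u : 'rV[R]_n) : 0 <= enorm u.
Proof. exact: sqrtr_ge0. Qed.

Lemma sqr_enorm (R : realType) n (u : 'rV[R]_n) : enorm u ^+ 2 = dot u u.
Proof. by rewrite sqr_sqrtr // dot_ge0. Qed.

Lemma enorm_le (R : realType) n (u : 'rV[R]_n) (a : R) :
  0 <= a -> (enorm u <= a) = (dot u u <= a ^+ 2).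
Proof. by move=> a0; rewrite -sqr_enorm ler_pXn2r ?nnegrE ?enorm_ge0. Qed.

Lemma enormZ (R : realType) n (a : R) (u : 'rV[R]_n) :
  enorm (a *: u) = `|a| * enorm u.
Proof.
by rewrite /enorm dotZl dotZr mulrA -expr2 sqrtrM ?sqr_ge0 // sqrtr_sqr.
Qed.

Lemma enormN (R : realType) n (u : 'rV[R]_n) : enorm (- u) = enorm u.
Proof. by rewrite -scaleN1r enormZ normrN1 mul1r. Qed.

Lemma enorm0 (R : realType) n : enorm (0 : 'rV[R]_n) = 0.
Proof. by rewrite -(scale0r (0 : 'rV[R]_n)) enormZ normr0 mul0r. Qed.

(** The limits in the theorem are taken in the sup norm, the lengths in the
    Euclidean one; this comparison is the only bridge between the two, the
    converse direction being provided by the continuity of the Euclidean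
    norm. *)
Lemma normr_le_enorm (R : realType) n (u : 'rV[R]_n) : `|u| <= enorm u.
Proof.
rewrite [leLHS]/Num.norm /= mx_normrE; apply: bigmax_le => [|[i j] _].
  exact: enorm_ge0.
rewrite /= (ord1 i) -sqrtr_sqr ler_wsqrtr // /dot (bigD1 j) //= -expr2 lerDl.
by apply: sumr_ge0 => k _; rewrite -expr2 sqr_ge0.
Qed.

Lemma enorm_gt0 (R : realType) n (u : 'rV[R]_n) : u != 0 -> 0 < enorm u.
Proof. by rewrite -normr_gt0 => /lt_le_trans; apply; exact: normr_le_enorm. Qed.

(** Cauchy-Schwarz, from the nonnegativity of the squared norm of
    [|v|^2 u - (u.v) v]. *)
Lemma dot_le_enorm (R : realType) n (u v : 'rV[R]_n) :
  dot u v <= enorm u * enorm v.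
Proof.
have [->|v0] := eqVneq v 0.
  by rewrite -(scale0r (0 : 'rV[R]_n)) dotZr mul0r scale0r enorm0 mulr0.
have vv : 0 < dot v v by rewrite -sqr_enorm exprn_gt0 // enorm_gt0.
apply: le_trans (ler_norm _) _; rewrite -sqrtr_sqr /enorm -sqrtrM ?dot_ge0 //.
apply: ler_wsqrtr.
have := dot_ge0 (dot v v *: u - dot u v *: v).
rewrite !(dotDl, dotDr, dotNl, dotNr, dotZl, dotZr) (dotC v u).
set a := dot u u; set b := dot u v; set c := dot v v => h.
rewrite -subr_ge0 -(pmulr_rge0 _ vv) -/c.
apply: le_trans h _; rewrite le_eqVlt; apply/orP; left; apply/eqP; ring.
Qed.

Lemma ler_enormD (R : realType) n (u v : 'rV[R]_n) :
  enorm (u + v) <= enorm u + enorm v.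
Proof.
rewrite enorm_le ?addr_ge0 ?enorm_ge0 // sqrrD !sqr_enorm.
rewrite !(dotDl, dotDr) (dotC v u).
have := dot_le_enorm u v; lra.
Qed.

(** * Continuity, compactness and lower semicontinuity *)

Lemma dot_continuous (R : realType) n (T : topologicalType)
    (f h : T -> 'rV[R]_n) :
  continuous f -> continuous h -> continuous (fun x => dot (f x) (h x)).
Proof.
move=> cf ch; rewrite /dot.
apply: (@continuous_big R 'I_n +%R 0 xpredT add_continuous T (index_enum _)
  (fun i x => f x ord0 i * h x ord0 i)) => i _ x.
apply: (@cvgM _ _ (nbhs x) _ (fun x => f x ord0 i) (fun x => h x ord0 i)).
  exact: (continuous_comp (cf x) (@coord_continuous _ _ _ ord0 i (f x))).
exact: (continuous_comp (ch x) (@coord_continuous _ _ _ ord0 i (h x))).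
Qed.

Lemma sqdist_continuous (R : realType) n (T : topologicalType)
    (f h : T -> 'rV[R]_n) :
  continuous f -> continuous h ->
  continuous (fun p => dot (f p - h p) (f p - h p)).
Proof.
move=> cf ch; have cB : continuous (fun p => f p - h p).
  by move=> p; apply: (@cvgB R _ _ (nbhs p) _ f h); [exact: cf|exact: ch].
exact: dot_continuous.
Qed.

Lemma enorm_continuous (R : realType) n (T : topologicalType)
    (f : T -> 'rV[R]_n) :
  continuous f -> continuous (fun x => enorm (f x)).
Proof.
move=> cf x.
exact: (continuous_comp (dot_continuous cf cf (x := x)) (@sqrt_continuous R _)).
Qed.

Lemma enorm_sub_continuous (R : realType) n (c : 'rV[R]_n) :
  continuous (fun x : 'rV[R]_n => enorm (x - c)).
Proof.
have cB : continuous (fun x : 'rV[R]_n => x - c).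
  by move=> x; apply: (@cvgB R _ _ (nbhs x) _ id (fun=> c));
    [exact: cvg_id|exact: cvg_cst].
exact: enorm_continuous cB.
Qed.

Lemma closed_sublevel (R : realType) (T : topologicalType) (f : T -> R)
    (r : R) :
  continuous f -> closed [set x | f x <= r].
Proof. by move/continuous_closedP => /(_ _ (@closed_le _ r)). Qed.

Lemma closed_fiber (R : realType) (T : topologicalType) (f : T -> R) (r : R) :
  continuous f -> closed [set x | f x = r].
Proof. by move/continuous_closedP => /(_ _ (@closed_eq _ r)). Qed.

Lemma compact_enorm_ball (R : realType) n (c : 'rV[R]_n) (r : R) :
  compact [set x | enorm (x - c) <= r].
Proof.
apply: bounded_closed_compact.
  exists (r + `|c|); split; first exact: num_real.
  move=> M hM x /= xr; rewrite -(subrK c x).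
  apply: le_trans (ler_normD _ _) (le_trans _ (ltW hM)).
  by rewrite lerD2r (le_trans (normr_le_enorm _)).
exact: closed_sublevel (@enorm_sub_continuous _ _ c).
Qed.

(** A point strictly below the graph is separated from it by a level lying
    strictly in between, and lower semicontinuity keeps the graph above that
    level nearby. *)
Lemma closed_epigraph (R : realType) (T : topologicalType) (g : T -> \bar R) :
  lower_semicontinuous g -> closed [set p : T * R | (g p.1 <= p.2%:E)%E].
Proof.
move=> lsc.
suff -> : [set p : T * R | (g p.1 <= p.2%:E)%E] =
    ~` [set p : T * R | (p.2%:E < g p.1)%E].
  apply: open_closedC; rewrite openE => -[x a] /= ag.
  have [b ab bg] : exists2 b, a < b & (b%:E < g x)%E.
    case: (g x) ag => [t| |] //.
      rewrite lte_fin => /midf_lt [? ?].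
      by exists ((a + t) / 2); rewrite ?lte_fin.
    by move=> _; exists (a + 1); rewrite ?ltrDl ?ltry.
  have [V xV Vg] := lsc _ _ bg.
  exists (V, [set t | t < b]) => /=.
    by split => //=; exact: lt_nbhsl.
  move=> [y t] [/= Vy tb]; apply: lt_trans (Vg _ Vy); by rewrite lte_fin.
by rewrite predeqE => p /=; rewrite leNgt; split => /negP.
Qed.

Lemma closed_ereal_sublevel (R : realType) (T : topologicalType)
    (g : T -> \bar R) (a : R) :
  lower_semicontinuous g -> closed [set x | (g x <= a%:E)%E].
Proof.
move=> /lower_semicontinuousP /(_ a) /open_closedC.
rewrite (_ : ~` _ = [set x | (g x <= a%:E)%E]) // predeqE => x /=.
by rewrite leNgt; split => /negP.
Qed.

(** * Vectors of the product space *)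

Lemma pair_mxB (R : realType) n (x y : 'rV[R]_n) (a b : R) :
  pair_mx x a - pair_mx y b = pair_mx (x - y) (a - b).
Proof.
rewrite /pair_mx opp_row_mx add_row_mx; congr row_mx.
by apply/rowP => i; rewrite !mxE.
Qed.

Lemma pair_mxZ (R : realType) n (x : 'rV[R]_n) (a t : R) :
  t *: pair_mx x a = pair_mx (t *: x) (t * a).
Proof.
rewrite /pair_mx scale_row_mx; congr row_mx.
by apply/rowP => i; rewrite !mxE.
Qed.

Lemma dot_pair_mx (R : realType) n (x y : 'rV[R]_n) (a b : R) :
  dot (pair_mx x a) (pair_mx y b) = dot x y + a * b.
Proof.
rewrite /dot big_split_ord /= big_ord1; congr (_ + _).
  by apply: eq_bigr => i _; rewrite !row_mxEl.
by rewrite !row_mxEr !mxE.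
Qed.

Lemma norm_pair_mx_le (R : realType) n (x : 'rV[R]_n) (a : R) :
  `|pair_mx x a| <= `|x| + `|a|.
Proof.
rewrite [leLHS]/Num.norm /= mx_normrE; apply: bigmax_le => [|[i j] _].
  by rewrite addr_ge0.
rewrite /= (ord1 i); case: (splitP j) => [k jk|k jk].
  have -> : j = lshift 1 k by apply: val_inj.
  rewrite row_mxEl; apply: (@le_trans _ _ `|x|); last by rewrite lerDl.
  by rewrite [leRHS]/Num.norm /= mx_normrE (le_bigmax _ _ (0, k)).
have -> : j = rshift n k by apply: val_inj.
by rewrite row_mxEr mxE lerDr.
Qed.

(** * Proximal normals and normals at infinity *)

Lemma near_enorm_lt (R : realType) n (c : 'rV[R]_n) (e : R) :
  0 < e -> \forall x \near c, enorm (x - c) < e.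
Proof.
move=> e0.
have := @enorm_sub_continuous R n c c.
rewrite /continuous_at subrr enorm0 => /cvgr_lt; exact.
Qed.

(** The normals met in the proof come from minimizing quadratic penalties, and
    so satisfy this one-sided quadratic estimate, which is easier to rescale
    than an upper limit of difference quotients. *)
Definition proximal_normal (R : realType) d (c : 'rV[R]_d) (C : set 'rV[R]_d) :
    set 'rV[R]_d :=
  [set v | exists M : R, \forall x \near c, C x ->
    dot v (x - c) <= M * dot (x - c) (x - c)].

Lemma proximal_normalZ (R : realType) d (c : 'rV[R]_d) C (a : R) v :
  0 <= a -> proximal_normal c C v -> proximal_normal c C (a *: v).
Proof.
move=> a0 [M vM]; exists (a * M); apply: filterS vM => x vM Cx.
by rewrite dotZl -mulrA ler_wpM2l // vM.
Qed.

(** The difference quotient is at most [M] times the distance to [c]. *)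
Lemma proximal_frechet_normal (R : realType) d (c : 'rV[R]_d) C :
  proximal_normal c C `<=` frechet_normal c C.
Proof.
move=> v [M vM]; apply/lee_addgt0Pr => e e0; rewrite add0e.
pose V := [set x : 'rV[R]_d | dot v (x - c) / enorm (x - c) <= e].
apply: (@le_trans _ _ (ereal_sup
    [set (dot v (x - c) / enorm (x - c))%:E | x in V])); last first.
  by apply: ge_ereal_sup => _ [x Vx <-]; rewrite lee_fin.
apply: ereal_inf_lbound; exists V => //.
have M1 : 0 < `|M| + 1 by rewrite ltr_wpDl.
have : \forall x \near c, x != c -> C x -> V x; last by [].
apply: filterS2 vM (near_enorm_lt c (divr_gt0 e0 M1)) => x vM xe xc Cx.
have x0 : 0 < enorm (x - c) by rewrite enorm_gt0 // subr_eq0.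
rewrite /V /= ler_pdivrMr // (le_trans (vM Cx)) // -sqr_enorm expr2 mulrA.
rewrite ler_wpM2r ?enorm_ge0 //; move: xe; rewrite ltr_pdivlMr // => xe.
apply: le_trans (ltW xe); rewrite mulrC ler_wpM2l ?enorm_ge0 //.
by rewrite (le_trans (ler_norm M)) // lerDl.
Qed.

Lemma cvg_dist_invS (R : realType) (V : pseudoMetricNormedZmodType R)
    (u : nat -> V) (l : V) :
  (forall k, `|l - u k| < k.+1%:R^-1) -> u @ \oo --> l.
Proof.
move=> ul; apply/cvgrPdist_lt => e e0.
apply: filterS (near_infty_natSinv_lt (PosNum e0)) => k; exact: lt_trans (ul k).
Qed.

Lemma cvgy_gt_nat (R : realType) (u : nat -> R) :
  (forall k, k%:R < u k) -> u @ \oo --> +oo.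
Proof.
move=> ku; apply/cvgryPgt => A; apply: filterS (nbhs_infty_gtr A) => k Ak.
exact: lt_trans Ak (ku k).
Qed.

(** The sequences in the definition are recovered by choosing approximations of
    order [1 / (k + 1)] beyond radius [k]; arguing with approximations saves
    the extraction of subsequences. *)
Lemma normal_at_infty_approx (R : realType) n (Omega : set 'rV[R]_n) v :
  (forall e M : R, 0 < e -> exists x w,
    [/\ Omega x, M < enorm x, frechet_normal x Omega w & `|v - w| < e]) ->
  normal_at_infty Omega v.
Proof.
move=> approx.
have [k|x xP] := @choice _ _ (fun k xw => [/\ Omega xw.1, k%:R < enorm xw.1,
    frechet_normal xw.1 Omega xw.2 & `|v - xw.2| < k.+1%:R^-1]) _.
  have [|x [w xwP]] := approx k.+1%:R^-1 k%:R; first by rewrite invr_gt0 ltr0n.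
  by exists (x, w).
exists (fun k => (x k).1), (fun k => (x k).2); split => [k||k|].
- by have [] := xP k.
- by apply: cvgy_gt_nat => k; have [] := xP k.
- by have [] := xP k.
- by apply: cvg_dist_invS => k; have [] := xP k.
Qed.

Lemma frechet_limiting_normal (R : realType) d (c : 'rV[R]_d) C v :
  C c -> frechet_normal c C v -> limiting_normal c C v.
Proof.
by move=> Cc Nv; exists (fun=> c), (fun=> v); split => //; exact: cvg_cst.
Qed.

Lemma epi_normal_at_infty_approx (R : realType) n (g : 'rV[R]_n -> \bar R) w :
  (forall e M : R, 0 < e -> exists x z,
    [/\ edom g x, M < enorm x,
        limiting_normal (pair_mx x (fine (g x))) (epi g) z & `|w - z| < e]) ->
  epi_normal_at_infty g w.
Proof.
move=> approx.
have [k|x xP] := @choice _ _ (fun k xz => [/\ edom g xz.1, k%:R < enorm xz.1,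
    limiting_normal (pair_mx xz.1 (fine (g xz.1))) (epi g) xz.2 &
    `|w - xz.2| < k.+1%:R^-1]) _.
  have [|x [z xzP]] := approx k.+1%:R^-1 k%:R; first by rewrite invr_gt0 ltr0n.
  by exists (x, z).
exists (fun k => (x k).1), (fun k => (x k).2); split => [k||k|].
- by have [] := xP k.
- by apply: cvgy_gt_nat => k; have [] := xP k.
- by have [] := xP k.
- by apply: cvg_dist_invS => k; have [] := xP k.
Qed.

(** * A penalized minimization problem *)

Lemma compact_separation (R : realType) n (A B : set 'rV[R]_n) :
  compact A -> compact B -> A `&` B = set0 ->
  exists2 d : R, 0 < d & forall x y, A x -> B y -> d <= dot (x - y) (x - y).
Proof.
move=> cA cB AB.
have [[p [Ap Bp]]|AB0] := pselect (A `*` B !=set0); last first.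
  by exists 1 => // x y Ax By; case: AB0; exists (x, y).
pose f (q : 'rV[R]_n * 'rV[R]_n) := dot (q.1 - q.2) (q.1 - q.2).
have cf : continuous f.
  by apply: sqdist_continuous => q; [exact: cvg_fst|exact: cvg_snd].
have [||q] := @compact_EVT_min _ _ f (A `*` B) _ (compact_setX cA cB).
- by exists p.
- exact: continuous_subspaceT.
rewrite inE => -[Aq Bq] qmin; exists (f q).
  rewrite lt_neqAle dot_ge0 andbT eq_sym /f -sqr_enorm sqrf_eq0 gt_eqF //.
  apply: enorm_gt0; rewrite subr_eq0; apply/eqP => q12.
  by rewrite -[False]/(set0 q.1) -AB; split => //; rewrite q12.
by move=> x y Ax By; apply: (qmin (x, y)); rewrite inE.
Qed.

(** The variables are decoupled: [(x, a)] runs over the part of the epigraph in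
    the closed upper half-space and [z] over [Omega]. The first penalty keeps
    [x] within distance [l] of [x0], because the value at the feasible point
    [(x0, r, x0)] is [r]. The second one makes [x] close to [Omega]; as no point
    of [Omega] within distance [l] of [x0] has a nonpositive value, the points
    of the ball where [g] is nonpositive are at a positive distance from
    [Omega], and a large weight [j] rules them out. *)
Lemma penalized_minimizer (R : realType) n (Omega : set 'rV[R]_n)
    (g : 'rV[R]_n -> \bar R) (x0 : 'rV[R]_n) (r l : R) :
  closed Omega -> lower_semicontinuous g ->
  Omega x0 -> g x0 = r%:E -> 0 < r -> 0 < l ->
  (forall y, Omega y -> (g y <= 0)%E -> l < enorm (y - x0)) ->
  exists j x a z, [/\ (g x <= a%:E)%E /\ Omega z, 0 < a,
    enorm (x - x0) <= l, enorm (x - z) <= 1 &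
    forall x' a' z', (g x' <= a'%:E)%E -> 0 <= a' -> Omega z' ->
      a + (r / l ^+ 2 * dot (x - x0) (x - x0) + j * dot (x - z) (x - z))
      <= a' + (r / l ^+ 2 * dot (x' - x0) (x' - x0)
               + j * dot (x' - z') (x' - z'))].
Proof.
move=> clO lsc Ox0 gx0 r0 l0 far.
pose BO := [set z | enorm (z - x0) <= l + 1] `&` Omega.
have cBO : compact BO.
  by apply: compact_closedI => //; exact: compact_enorm_ball.
have [d d0 dsep] : exists2 d : R, 0 < d & forall x z,
    ([set x | enorm (x - x0) <= l] `&` [set x | (g x <= 0%:E)%E]) x -> BO z ->
    d <= dot (x - z) (x - z).
  apply: compact_separation => //.
    apply: compact_closedI; [exact: compact_enorm_ball|].
    exact: closed_ereal_sublevel.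
  rewrite -subset0 => y [[/= yl gy] [_ Oy]].
  by move: (far _ Oy gy); rewrite ltNge yl.
(* r <= j gives enorm (x - z) <= 1, and r < j * d excludes a = 0. *)
pose j := r + (r + 1) / d.
have rj : r <= j by rewrite lerDl divr_ge0 // ?addr_ge0 // ltW.
have j0 : 0 < j by exact: lt_le_trans rj.
pose c := r / l ^+ 2.
have c0 : 0 < c by rewrite divr_gt0 // exprn_gt0.
pose F (p : 'rV[R]_n * R * 'rV[R]_n) := p.1.2
  + (c * dot (p.1.1 - x0) (p.1.1 - x0) + j * dot (p.1.1 - p.2) (p.1.1 - p.2)).
pose K : set ('rV[R]_n * R * 'rV[R]_n) :=
  (([set x | enorm (x - x0) <= l] `*` `[0, r]%classic)
    `&` [set p | (g p.1 <= p.2%:E)%E]) `*` BO.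
have cK : compact K.
  apply: compact_setX => //; apply: compact_closedI.
    by apply: compact_setX; [exact: compact_enorm_ball|exact: segment_compact].
  exact: closed_epigraph.
have K0 : K (x0, r, x0).
  have lc t : 0 <= t -> [set x | enorm (x - x0) <= t] x0.
    by rewrite /= subrr enorm0.
  split; [split|split] => //=; last 2 first.
  - by rewrite gx0.
  - by apply: lc; rewrite addr_ge0 // ltW.
  by split => /=; [apply: lc; rewrite ltW|rewrite in_itv /= lexx ltW].
have cF : continuous F.
  have cfst1 : continuous (fun p : 'rV[R]_n * R * 'rV[R]_n => p.1.1).
    by move=> p; apply: cvg_comp; exact: cvg_fst.
  have cfst2 : continuous (fun p : 'rV[R]_n * R * 'rV[R]_n => p.1.2).
    by move=> p; apply: cvg_comp; [exact: cvg_fst|exact: cvg_snd].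
  have csnd : continuous (fun p : 'rV[R]_n * R * 'rV[R]_n => p.2).
    by move=> p; exact: cvg_snd.
  have c0' : continuous (fun _ : 'rV[R]_n * R * 'rV[R]_n => x0).
    by move=> p; exact: cvg_cst.
  move=> p; apply: cvgD; first exact: cfst2.
  apply: cvgD; apply: cvgM; try exact: cvg_cst.
    exact: (sqdist_continuous cfst1 c0').
  exact: (sqdist_continuous cfst1 csnd).
have [||[[x a] z]] := @compact_EVT_min _ _ F K _ cK.
- by exists (x0, r, x0).
- exact: continuous_subspaceT.
rewrite inE => -[[[/= xl]]].
rewrite in_itv /= => /andP[a0 ar] gxa [/= zl Oz] pmin.
have Fr : F (x, a, z) <= r.
  apply: le_trans (pmin (x0, r, x0) _) _; first by rewrite inE.
  by rewrite /F /= subrr -sqr_enorm enorm0 expr0n /= !mulr0 !addr0.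
exists j, x, a, z; split => //.
- rewrite lt_neqAle a0 andbT; apply/eqP => a0'.
  have := dsep x z; rewrite /= => /(_ (conj xl _) (conj zl Oz)).
  rewrite a0' => /(_ gxa) dxz.
  move: Fr; rewrite leNgt => /negP; apply.
  rewrite /F /= -a0' add0r; apply: (@lt_le_trans _ _ (j * d)).
    rewrite /j mulrDl divfK ?gt_eqF //; apply: (@lt_le_trans _ _ (r + 1)).
      by rewrite ltrDl.
    by rewrite lerDr mulr_ge0 // ltW.
  apply: (@le_trans _ _ (j * dot (x - z) (x - z))); first by rewrite ler_pM2l.
  by rewrite lerDr mulr_ge0 ?dot_ge0 // ltW.
- rewrite enorm_le // expr1n -(ler_pM2l j0) mulr1; apply: le_trans rj.
  apply: le_trans Fr; rewrite /F /= addrA lerDr addr_ge0 //.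
  by rewrite mulr_ge0 ?dot_ge0 // ltW.
- move=> x' a' z' gx' a'0 Oz'.
  have Q0 : 0 <= c * dot (x' - x0) (x' - x0).
    by rewrite mulr_ge0 ?dot_ge0 // ltW.
  have J0 : 0 <= j * dot (x' - z') (x' - z').
    by rewrite mulr_ge0 ?dot_ge0 // ltW.
  (* Outside of K the penalized value is at least r, so that a minimizer over
     K is a minimizer over all the feasible points. *)
  have big : r <= F (x', a', z') -> F (x, a, z) <= F (x', a', z').
    exact: le_trans.
  rewrite -/c -[leLHS]/(F (x, a, z)) -[leRHS]/(F (x', a', z')).
  have [ra'|a'r] := leP r a'.
    by apply: big; rewrite /F /= (le_trans ra') // lerDl addr_ge0.
  have [lx'|x'l] := leP (enorm (x' - x0)) l; last first.
    apply: big; rewrite /F /= -[leLHS]add0r lerD // -[leLHS]addr0 lerD //.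
    rewrite /c -mulrA ler_peMr // ?(ltW r0) // mulrC ler_pdivlMr ?exprn_gt0 //.
    by rewrite mul1r -sqr_enorm ler_pXn2r ?nnegrE ?enorm_ge0 // ltW.
  have [zx'|x'z] := leP (enorm (x' - z')) 1; last first.
    apply: big; rewrite /F /= -[leLHS]add0r lerD // -[leLHS]add0r lerD //.
    rewrite (le_trans rj) // ler_peMr // ?(ltW j0) // -sqr_enorm.
    by rewrite -[leLHS](expr1n _ 2) ler_pXn2r ?nnegrE ?enorm_ge0 // ltW.
  apply: pmin; rewrite inE; split; split => //=.
    by split => //=; rewrite in_itv /= a'0 ltW.
  have -> : z' - x0 = (x' - x0) + (z' - x') by rewrite [RHS]addrC addrA subrK.
  by rewrite (le_trans (ler_enormD _ _)) // lerD // -opprB enormN.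
Qed.

(** First-order conditions at the penalized minimizer. Minimality in [z] makes
    [2 j (x - z)] normal to [Omega] at [z]; minimality in [(x, a)] makes the
    opposite of the gradient of the objective normal to the epigraph. The
    gradients of the coupling term cancel in the sum, and what remains is the
    gradient of the first penalty, of norm at most [2 (r / l^2) l]. The
    constraint [0 <= a] is inactive near a point with [0 < a]. *)
Lemma penalized_normals (R : realType) n (Omega : set 'rV[R]_n)
    (g : 'rV[R]_n -> \bar R) (x0 : 'rV[R]_n) (r l : R) :
  closed Omega -> (forall x, g x != -oo%E) -> lower_semicontinuous g ->
  Omega x0 -> g x0 = r%:E -> 0 < r -> 0 < l ->
  (forall y, Omega y -> (g y <= 0)%E -> l < enorm (y - x0)) ->
  exists x z u v, [/\ edom g x /\ Omega z,
    enorm (x - x0) <= l /\ enorm (x - z) <= 1,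
    proximal_normal (pair_mx x (fine (g x))) (epi g) (pair_mx u (- 1)),
    proximal_normal z Omega v &
    enorm (u + v) <= 2 * (r / l)].
Proof.
move=> clO gNy lsc Ox0 gx0 r0 l0 far.
have [j [x [a [z [[gxa Oz] a0 xl xz pmin]]]]] :=
  penalized_minimizer clO lsc Ox0 gx0 r0 l0 far.
set c := r / l ^+ 2 in pmin.
have c0 : 0 < c by rewrite divr_gt0 // exprn_gt0.
(* Lowering a to the positive part of g x would otherwise decrease the value. *)
have gx : g x = a%:E.
  case gxE : (g x) (gNy x) gxa => [t| |] //= _; rewrite lee_fin => ta.
  congr EFin; apply/eqP; rewrite eq_le ta /=.
  have := pmin x (Num.max t 0) z; rewrite lerD2r gxE lee_fin !le_max lexx /=.
  rewrite lexx orbT => /(_ isT isT Oz) /orP[//|].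
  by rewrite leNgt a0.
exists x, z, (- (2 * c) *: (x - x0) - (2 * j) *: (x - z)), ((2 * j) *: (x - z)).
split => //.
- by split; rewrite // /edom /= gx ltry.
- rewrite gx /=; exists (c + `|j|).
  apply: filterS (near_enorm_lt (pair_mx x a) a0) => p + [x' [a' [pE gx']]].
  rewrite {p}pE !pair_mxB !dot_pair_mx -ltr_sqr ?nnegrE ?enorm_ge0 ?(ltW a0) //.
  rewrite sqr_enorm dot_pair_mx => near_a.
  have sx0 := dot_ge0 (x' - x).
  have a'0 : 0 <= a' by nra.
  have := pmin x' a' z gx' a'0 Oz.
  rewrite (sqdist_expand x x' x0) (sqdist_expand x x' z).
  rewrite (dotDl (- _ *: _)) dotNl !dotZl.
  have jj : j * dot (x' - x) (x' - x) <= `|j| * dot (x' - x) (x' - x).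
    by rewrite ler_wpM2r // ler_norm.
  have h2 : 0 <= (c + `|j|) * ((a' - a) * (a' - a)).
    by rewrite mulr_ge0 ?addr_ge0 ?(ltW c0) // -expr2 sqr_ge0.
  lra.
- exists j; apply: (@filterE _ (nbhs z)) => z' Oz'.
  have := pmin x a z' gxa (ltW a0) Oz'.
  have sqdC (p q : 'rV[R]_n) : dot (p - q) (p - q) = dot (q - p) (q - p).
    by rewrite -opprB dotNl dotNr opprK.
  rewrite (sqdC x z') (sqdist_expand z z' x) (sqdC z x) -(opprB x z).
  by rewrite dotNl !dotZl; lra.
- have c2 : 0 < 2 * c by rewrite pmulr_rgt0.
  rewrite subrK enormZ normrN gtr0_norm // -mulrA.
  rewrite ler_pM2l //; apply: (@le_trans _ _ (c * l)).
    by rewrite ler_pM2l.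
  by rewrite /c expr2 invfM -!mulrA mulVf ?gt_eqF // mulr1.
Qed.

Lemma dist_set_gt (R : realType) n (x : 'rV[R]_n) A (l : R) :
  (l%:E < dist_set x A)%E -> forall y, A y -> l < enorm (y - x).
Proof.
move=> lA y Ay; rewrite -lte_fin; apply: lt_le_trans lA _.
by apply: ereal_inf_lbound; exists y.
Qed.

Definition nearly_opposite_normals (R : realType) n (g : 'rV[R]_n -> \bar R)
    (Omega : set 'rV[R]_n) : Prop :=
  forall e M : R, 0 < e -> exists x z u v,
    [/\ edom g x /\ Omega z, M < enorm x /\ M < enorm z,
      proximal_normal (pair_mx x (fine (g x))) (epi g) (pair_mx u (- 1)),
      proximal_normal z Omega v & `|u + v| < e].

Definition error_bound_at_infty (R : realType) n (g : 'rV[R]_n -> \bar R)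
    (Omega S : set 'rV[R]_n) : Prop :=
  exists alpha rho : R, [/\ 0 < alpha, 0 < rho &
    forall x, Omega x -> rho < enorm x ->
      (dist_set x S <= alpha%:E * maxe (g x) 0)%E].

(** A point [x0] violating the bound with constant [k] has value [r > 0] and is
    at a distance greater than [k r] from [S]. The penalized problem on the ball
    of radius [k r / 2] then yields normals whose sum is of order [1 / k]. That
    [S] is nonempty bounds the radius by half of the norm of [x0], up to a
    constant. *)
Lemma far_opposite_normals (R : realType) n (Omega S : set 'rV[R]_n)
    (g : 'rV[R]_n -> \bar R) :
  closed Omega -> (forall x, g x != -oo%E) -> lower_semicontinuous g ->
  S = [set x | Omega x /\ (g x <= 0)%E] -> S !=set0 ->
  ~ error_bound_at_infty g Omega S ->
  nearly_opposite_normals g Omega.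
Proof.
move=> clO gNy lsc SE [s0 Ss0] nEB e M e0.
(* The normals found below add up to at most 2 * (r / l) = 4 / k = e / 2. *)
pose k : R := 8 / e.
have k0 : 0 < k by rewrite divr_gt0.
(* enorm x is at least (enorm x0 - enorm s0) / 2, and enorm z at least that
   minus one: this is more than M as soon as rho < enorm x0. *)
pose rho := `|2 * M| + enorm s0 + 2.
have rho0 : 0 < rho by rewrite ltr_wpDl // addr_ge0 // enorm_ge0.
have [x0 [Ox0 rx0 bad]] : exists x, [/\ Omega x, rho < enorm x &
    (k%:E * maxe (g x) 0 < dist_set x S)%E].
  apply: contrapT => no; apply: nEB; exists k, rho; split => // x Ox rx.
  by rewrite leNgt; apply/negP => h; apply: no; exists x.
have [r gx0 r0] : exists2 r, g x0 = r%:E & 0 < r.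
  case gxE : (g x0) bad (gNy x0) => [r| |] // bad _; last first.
    by move: bad; rewrite maxye mulry gtr0_sg // mul1e ltNge leey.
  exists r => //; rewrite ltNge; apply/negP => r0; move: bad.
  rewrite max_r ?lee_fin // mule0 => /dist_set_gt /(_ x0).
  rewrite SE /= gxE lee_fin subrr enorm0 ltxx => H; by have := H (conj Ox0 r0).
have {}bad : ((k * r)%:E < dist_set x0 S)%E.
  by move: bad; rewrite gx0 max_l ?lee_fin ?(ltW r0) // EFinM.
have kr0 : 0 < k * r by rewrite mulr_gt0.
(* Below half of the distance from x0 to S: the search ball around x0 avoids S,
   and is small enough with respect to the distance from x0 to s0 for all its
   points to be large when x0 is. *)
pose l := k * r / 2.
have l0 : 0 < l by rewrite divr_gt0.
have far y : Omega y -> (g y <= 0)%E -> l < enorm (y - x0).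
  move=> Oy gy; apply: (@lt_trans _ _ (k * r)).
    by rewrite /l ltr_pdivrMr // ltr_pMr // ltr1n.
  by apply: (dist_set_gt bad); rewrite SE.
have ls0 : 2 * l < enorm s0 + enorm x0.
  apply: (@lt_le_trans _ _ (enorm (s0 - x0))).
    by rewrite /l mulrC divfK // (dist_set_gt bad).
  by rewrite -(enormN x0) ler_enormD.
have [x [z [u [v [[dx Oz] [xl xz] Nu Nv uv]]]]] :=
  penalized_normals clO gNy lsc Ox0 gx0 r0 l0 far.
have x0x : enorm x0 <= enorm x + enorm (x - x0).
  rewrite -(enormN (x - x0)) (le_trans _ (ler_enormD _ _)) //.
  by rewrite opprB addrC subrK.
have xz' : enorm x <= enorm z + enorm (x - z).
  by rewrite (le_trans _ (ler_enormD _ _)) // addrC subrK.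
have M2 := ler_norm (2 * M).
exists x, z, u, v; split => //; first by split; rewrite /rho in rx0; lra.
apply: le_lt_trans (normr_le_enorm _) (le_lt_trans uv _).
rewrite (_ : 2 * (r / l) = e / 2); first by lra.
by rewrite /l /k; field; rewrite ?gt_eqF.
Qed.

(** * Limits of opposite normals *)

(** [(- v, - s)] is a limit of normals to the epigraph and [v] a limit of
    normals to [Omega], at points going to infinity. Normals form cones,
    so the pairs [(v, s)] do too: leaving [s] free allows to normalize it only
    after the limit has been taken. *)
Definition opposite_normal_limit (R : realType) n (g : 'rV[R]_n -> \bar R)
    (Omega : set 'rV[R]_n) (v : 'rV[R]_n) (s : R) : Prop :=
  forall e M : R, 0 < e -> exists x z u w t,
    [/\ edom g x /\ Omega z, M < enorm x /\ M < enorm z,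
      proximal_normal (pair_mx x (fine (g x))) (epi g) (pair_mx u (- t)),
      proximal_normal z Omega w &
      [/\ `|u + w| < e, `|v - w| < e & `|s - t| < e]].

Lemma opposite_normal_limitZ (R : realType) n (g : 'rV[R]_n -> \bar R)
    Omega v (s a : R) :
  0 < a -> opposite_normal_limit g Omega v s ->
  opposite_normal_limit g Omega (a *: v) (a * s).
Proof.
move=> a0 lim e M e0.
have [x [z [u [w [t [xz Mxz Nu Nw [uw vw st]]]]]]] :=
  lim (e / a) M (divr_gt0 e0 a0).
exists x, z, (a *: u), (a *: w), (a * t); split => //.
- by rewrite -mulrN -pair_mxZ; apply: proximal_normalZ Nu; exact: ltW.
- by apply: proximal_normalZ Nw; exact: ltW.
by rewrite -scalerDr -scalerBr -mulrBr !normrZ gtr0_norm //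
  !(mulrC a) -!ltr_pdivlMr.
Qed.

Lemma opposite_normal_limit_normal (R : realType) n (g : 'rV[R]_n -> \bar R)
    Omega v (s : R) :
  opposite_normal_limit g Omega v s -> normal_at_infty Omega v.
Proof.
move=> lim; apply: normal_at_infty_approx => e M e0.
have [x [z [u [w [t [[_ Oz] [_ Mz] _ Nw [_ vw _]]]]]]] := lim e M e0.
by exists z, w; split => //; exact: proximal_frechet_normal.
Qed.

Lemma opposite_normal_limit_epi (R : realType) n (g : 'rV[R]_n -> \bar R)
    Omega v (s : R) :
  (forall x, g x != -oo%E) -> opposite_normal_limit g Omega v s ->
  epi_normal_at_infty g (pair_mx (- v) (- s)).
Proof.
move=> gNy lim; apply: epi_normal_at_infty_approx => e M e0.
have [|x [z [u [w [t [[dx _] [Mx _] Nu _ [uw vw st]]]]]]] := lim (e / 3) M.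
  by rewrite divr_gt0.
exists x, (pair_mx u (- t)); split => //.
  apply: frechet_limiting_normal; last exact: proximal_frechet_normal.
  exists x, (fine (g x)); split => //; rewrite fineK // fin_numE gNy /=.
  by rewrite -ltey.
rewrite pair_mxB (le_lt_trans (norm_pair_mx_le _ _)) //.
have -> : - v - u = - (v - w) - (u + w).
  by rewrite opprB opprD [RHS]addrC -addrA addKr addrC.
have h1 := ler_normB (- (v - w)) (u + w).
rewrite [`|- (v - w)|]normrN in h1.
have -> : `|- s - - t| = `|s - t| by rewrite -opprD normrN.
lra.
Qed.

(** The normals [v] to [Omega] may be unbounded. Dividing [(v, 1)] by
    [1 + |v|] places it on the compact set [|v| + s = 1, 0 <= s], where it has
    a cluster point. The case [s = 0] is the one in which the normals blow
    up. *)
Lemma normalized_opposite_normals (R : realType) n (g : 'rV[R]_n -> \bar R)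
    (Omega : set 'rV[R]_n) :
  nearly_opposite_normals g Omega ->
  exists v s, [/\ 0 <= s, `|v| + s = 1 & opposite_normal_limit g Omega v s].
Proof.
move=> far.
have [k|q qP] := @choice _ _ (fun k q =>
    [/\ edom g q.1.1 /\ Omega q.1.2, k%:R < enorm q.1.1 /\ k%:R < enorm q.1.2,
      proximal_normal (pair_mx q.1.1 (fine (g q.1.1))) (epi g)
        (pair_mx q.2.1 (- 1)),
      proximal_normal q.1.2 Omega q.2.2 & `|q.2.1 + q.2.2| < k.+1%:R^-1]) _.
  have [|x [z [u [v xzuv]]]] := far k.+1%:R^-1 k%:R.
    by rewrite invr_gt0 ltr0n.
  by exists ((x, z), (u, v)).
pose t k := (1 + `|(q k).2.2|)^-1.
have D1 k : 1 <= 1 + `|(q k).2.2| by rewrite lerDl.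
have t0 k : 0 < t k by rewrite invr_gt0 (lt_le_trans ltr01).
have t1 k : t k <= 1 by rewrite invf_le1 // (lt_le_trans ltr01).
pose p k : 'rV[R]_n * R := (t k *: (q k).2.2, t k).
have pE k : `|(p k).1| + (p k).2 = 1.
  rewrite /= normrZ gtr0_norm // -[X in _ + X]mulr1 -mulrDr addrC.
  by rewrite mulVf // gt_eqF // (lt_le_trans ltr01).
pose ball1 : set 'rV[R]_n := [set v | `|v| <= 1].
have cball1 : compact ball1.
  apply: bounded_closed_compact.
    exists 1; split; first exact: num_real.
    by move=> M M1 v /le_trans; apply; exact: ltW.
  by apply: closed_sublevel => v; exact: norm_continuous.
have cnorm : continuous (fun p : 'rV[R]_n * R => `|p.1| + p.2).
  move=> y; apply: cvgD; last exact: cvg_snd.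
  by apply: cvg_norm; exact: cvg_fst.
have cK : compact ((ball1 `*` `[0, 1]%classic) `&`
    [set p : 'rV[R]_n * R | `|p.1| + p.2 = 1]).
  apply: compact_closedI.
    by apply: compact_setX => //; exact: segment_compact.
  exact: closed_fiber cnorm.
have [|[v s] [[[_ /=]]]] := cK (p @ \oo) _.
  apply: (@filterE _ \oo) => k; split; [split => /=|exact: pE].
    by have := pE k; have := t0 k; rewrite /ball1 /p /=; lra.
  by rewrite in_itv /= t1 ltW.
rewrite in_itv /= => /andP[s0 _] vs1 clus; exists v, s; split => // e M e0.
have [N MN] : exists N : nat,
    forall k, (N <= k)%N -> M < k%:R /\ k.+1%:R^-1 < e.
  have := filterI (nbhs_infty_gtr M) (near_infty_natSinv_lt (PosNum e0)).
  by move=> [N _ NP]; exists N => k /NP.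
have [||_ [[k Nk <-] [vk sk]]] := clus [set p k | k in [set k | (N <= k)%N]]
    [set y | `|v - y.1| < e /\ `|s - y.2| < e].
- by exists N => // k Nk; exists k.
- exists ([set y | `|v - y| < e], [set y | `|s - y| < e]) => //=.
  by split => /=; [exact: (@cvgr_dist_lt _ _ _ (nbhs v) _ id v (@cvg_id _ _))|
    exact: (@cvgr_dist_lt _ _ _ (nbhs s) _ id s (@cvg_id _ _))].
have [Mk ke] := MN _ Nk; have [dO [xk zk] Nu Nv uv] := qP k.
exists (q k).1.1, (q k).1.2, (t k *: (q k).2.1), (t k *: (q k).2.2), (t k).
split => //.
- by split; exact: lt_trans Mk _.
- have -> : - t k = t k * - 1 by rewrite mulrN1.
  by rewrite -pair_mxZ; apply: proximal_normalZ Nu; exact: ltW.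
- by apply: proximal_normalZ Nv; exact: ltW.
split => //; rewrite -scalerDr normrZ gtr0_norm //.
apply: le_lt_trans (lt_trans uv ke).
by rewrite ler_piMl // t1.
Qed.

(** * The error bound *)

Theorem theorem3p1 (R : realType) (n : nat)
    (Omega : set 'rV[R]_n) (g : 'rV[R]_n -> \bar R) (S : set 'rV[R]_n)
    (Omega_neq0 : Omega !=set0)
    (Omega_closed : closed Omega)
    (g_neqNy : forall x, g x != -oo%E)
    (g_lsc : lower_semicontinuous g)
    (dom_neq0 : Omega `&` edom g !=set0)
    (dom_unbounded : unbounded (Omega `&` edom g))
    (S_def : S = [set x | Omega x /\ (g x <= 0)%E])
    (S_neq0 : S !=set0)
    (qualification :
       singular_subdiff_at_infty g
         `&` [set - v | v in normal_at_infty Omega] = [set 0])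
    (regularity :
       ~ [set u + v | u in subdiff_at_infty g & v in normal_at_infty Omega] 0) :
  exists alpha rho : R, [/\ 0 < alpha, 0 < rho &
    forall x, Omega x -> rho < enorm x ->
      (dist_set x S <= alpha%:E * maxe (g x) 0)%E].
Proof.
apply: contrapT => noEB.
have [v [s [s0 vs1 lim]]] := normalized_opposite_normals
  (far_opposite_normals Omega_closed g_neqNy g_lsc S_def S_neq0 noEB).
move: s0; rewrite le_eqVlt => /predU1P[s0|s0].
  (* A unit vector contradicting the qualification condition. *)
  subst s; have v0 : - v = 0.
    have : [set 0] (- v); last by [].
    rewrite -qualification; split.
      by rewrite /singular_subdiff_at_infty /= -[0]oppr0;
        exact: opposite_normal_limit_epi lim.
    by exists v => //; exact: opposite_normal_limit_normal lim.
  move: vs1; rewrite -normrN v0 normr0 addr0 => /esym/eqP.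
  by rewrite oner_eq0.
(* Otherwise rescaling to s = 1 contradicts the regularity condition. *)
have {}lim : opposite_normal_limit g Omega (s^-1 *: v) 1.
  rewrite -(mulVf (lt0r_neq0 s0)); apply: opposite_normal_limitZ lim.
  by rewrite invr_gt0.
apply: regularity; exists (- (s^-1 *: v)).
  exact: opposite_normal_limit_epi lim.
exists (s^-1 *: v); last by rewrite addNr.
exact: opposite_normal_limit_normal lim.
Qed.
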